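(* For every Borel set $B\subseteq(0;1)$ there is a solid closed set $A\subseteq 2^\omega$, and also a solid open set $A\subseteq 2^\omega$, such that $\operatorname{ran}\mathcal{D}_A=\{0,1\}\cup B$ and $A\in\mathrm{Rng}_{\mathrm{inj}}$, i.e. for all $z_1,z_2\in 2^\omega$, if $\mathcal{D}_A(z_1)=\mathcal{D}_A(z_2)\in(0;1)$ then $z_1=z_2$.
   Context: $2^{\omega}$ is the Cantor space with the product topology; for a finite binary sequence $s$ let $N_s=\{x\in 2^\omega: s\subset x\}$. $\mu$ is the coin-tossing probability measure on $2^\omega$, with $\mu(N_s)=2^{-\mathrm{lh}(s)}$. For measurable $A\subseteq 2^\omega$ and $z\in 2^\omega$, $\mathcal{D}_A(z)=\lim_{n\to\infty}\mu(A\cap N_{z\restriction n})/\mu(N_{z\restriction n})$, defined only when the limit exists; $\operatorname{ran}\mathcal{D}_A$ is the set of values attained at points where it is defined. A point is blurry for $A$ if $\mathcal{D}_A$ is undefined there; $A$ is solid if it has no blurry points. *)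

(* Defs.v *)
From HB Require Import structures.
From mathcomp Require Import all_boot all_order all_algebra.
From mathcomp Require Import all_classical all_reals all_analysis.
Set Implicit Arguments. Unset Strict Implicit. Unset Printing Implicit Defensive.
Import Order.TTheory GRing.Theory Num.Theory.
Import numFieldNormedType.Exports.
Local Open Scope classical_set_scope.
Local Open Scope ring_scope.

(* The n-th binary digit (n = 0, 1, ...) of t in [0,1): t = sum_n bit n / 2^(n+1). *)
Definition bin_digits {R : realType} (t : R) : cantor_space :=
  fun n => (1 <= 2 ^+ n.+1 * t - 2 * (Num.floor (2 ^+ n * t))%:~R).

(* Coin-tossing measure on 2^omega: pushforward of Lebesgue measure on [0,1)
   by the binary-digit map (this map sends Lebesgue measure to the product of
   fair coin measures). *)
Definition coin_mu {R : realType} (X : set cantor_space) : \bar R :=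
  (@lebesgue_measure R) [set t : R | 0 <= t < 1 /\ X (bin_digits t)].

Definition cyl (z : cantor_space) (n : nat) : set cantor_space :=
  [set x | forall i, (i < n)%N -> x i = z i].

Definition density_at {R : realType} (A : set cantor_space) (z : cantor_space) (r : R) : Prop :=
  (fun n : nat => fine (coin_mu (A `&` cyl z n)) / fine (@coin_mu R (cyl z n)))
    @ \oo --> r.

Definition ran_density {R : realType} (A : set cantor_space) : set R :=
  [set r | exists z, density_at A z r].

Definition solid (R : realType) (A : set cantor_space) : Prop :=
  forall z, exists r : R, density_at A z r.

Definition Rng_inj (R : realType) (A : set cantor_space) : Prop :=
  forall (z1 z2 : cantor_space) (r : R), 0 < r < 1 ->
    density_at A z1 r -> density_at A z2 r -> z1 = z2.

(* Main.v *)
Require Import Defs.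
From HB Require Import structures.
From mathcomp Require Import all_boot all_order all_algebra.
From mathcomp Require Import all_classical all_reals all_analysis.
From mathcomp Require Import ring lra zify.
Import Order.TTheory GRing.Theory Num.Theory.
Import numFieldNormedType.Exports.
Local Open Scope classical_set_scope.
Local Open Scope ring_scope.

(* By Lusin-Souslin, B carries an injective coding [w] by the points of a closed
   subset of Baire space.  Put a dyadic-valued martingale with values in [0, 1] on
   the binary tree that converges along every branch and reaches 0 or 1 along almost
   every one; then the union of the cylinders where it is 1, and the complement of
   the union of those where it is 0, both have it as their density.
   A live node stands for the points of B whose codes share a prefix, one of them
   being designated.  Staying forever leads to the designated point p; the k-th exit
   leads to the node of the points whose code leaves that of p at the k-th place and
   digit, so that live branches correspond bijectively to points of B.  Between two
   such choices one sibling is sacrificed (it reaches 0 or 1 in finitely many steps)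
   to move the density of the other towards the designated point. *)

(** * Borel sets as closed sets of codes *)

Definition agree {T : Type} (n : nat) (x y : nat -> T) : Prop :=
  forall i, (i < n)%N -> x i = y i.

Lemma agree_sym {T : Type} n (x y : nat -> T) : agree n x y -> agree n y x.
Proof. by move=> xy i /xy. Qed.

Lemma agree_trans {T : Type} n (y x z : nat -> T) :
  agree n x y -> agree n y z -> agree n x z.
Proof. by move=> xy yz i ni; rewrite xy // yz. Qed.

Lemma agree_le {T : Type} m n (x y : nat -> T) :
  (m <= n)%N -> agree n x y -> agree m x y.
Proof. by move=> mn xy i im; apply: xy; apply: leq_trans mn. Qed.

Lemma agreeS {T : Type} n (x y : nat -> T) :
  agree n.+1 x y <-> agree n x y /\ x n = y n.
Proof.
split=> [xy|[xy xyn] i]; first by split; [exact: agree_le xy|exact: xy].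
by rewrite ltnS leq_eqVlt => /predU1P[->//|]; apply: xy.
Qed.

Lemma agree_ext {T : Type} (x y : nat -> T) : (forall n, agree n x y) -> x = y.
Proof. by move=> xy; apply/funext => i; apply: (xy i.+1). Qed.

Definition closed_rel (F : (nat -> nat) -> (nat -> nat) -> Prop) : Prop :=
  forall x y, (forall n, exists x' y',
    [/\ agree n x' x, agree n y' y & F x' y']) -> F x y.

(** Injective projections of closed sets. Uniqueness of the witness is what later makes the coding
    of [B] injective. *)
Definition unique_closed_proj (S : set (nat -> nat)) : Prop :=
  exists F, [/\ closed_rel F, (forall y, S y <-> exists x, F x y) &
    (forall x x' y, F x y -> F x' y -> x = x')].

(** The witness stores in its first entry the least length of an initial segment of [y] that forces
    membership in [S], and zeros elsewhere. Minimality gives uniqueness, and each condition involves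
    only finitely many entries, whence closedness. *)
Lemma unique_closed_proj_open (S : set (nat -> nat)) :
  (forall y, S y -> exists n, forall y', agree n y' y -> S y') ->
  unique_closed_proj S.
Proof.
move=> Sopen; pose P n y := forall y', agree n y' y -> S y'.
have PP n y y' : agree n y' y -> P n y -> P n y'.
  by move=> yy' Py y2 y2y; apply: Py; apply: agree_trans yy'.
exists (fun x y => [/\ P (x 0%N) y, (forall m, (m < x 0%N)%N -> ~ P m y) &
  forall k, x k.+1 = 0%N]); split.
- move=> x y xy; split.
  + have [x' [y' [xx yy [Py _ _]]]] := xy (x 0%N).+1.
    rewrite xx // in Py; apply: PP Py.
    by apply: agree_sym; apply: agree_le yy.
  + move=> m mx Pm; have [x' [y' [xx yy [_ Py _]]]] := xy (x 0%N).+1.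
    apply: (Py m); first by rewrite xx.
    by apply: PP Pm; apply: agree_le yy; rewrite ltnW // ltnW.
  + move=> k; have [x' [y' [xx yy [_ _ Py]]]] := xy k.+2.
    by rewrite -xx.
- move=> y; split=> [/Sopen Sy|[x [Py _ _]]]; last exact: Py.
  have exn : exists n, `[<P n y>] by case: Sy => n Pn; exists n; apply/asboolP.
  exists (fun i => if i is 0%N then ex_minn exn else 0%N).
  case: ex_minnP => m /asboolP Pm mmin; split=> // k km /asboolP /mmin.
  by rewrite leqNgt km.
- move=> x x' y [Px xmin x0] [Px' xmin' x0']; apply/funext => -[|k]; last first.
    by rewrite x0 x0'.
  by apply/eqP; rewrite eqn_leq; apply/andP; split; rewrite leqNgt; apply/negP;
    [move=> /xmin|move=> /xmin'].
Qed.

Lemma unique_closed_proj_closed (S : set (nat -> nat)) :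
  (forall y, (forall n, exists y', agree n y' y /\ S y') -> S y) ->
  unique_closed_proj S.
Proof.
move=> Sc; exists (fun x y => x = (fun=> 0%N) /\ S y); split.
- move=> x y xy; split.
    apply/funext => i; have [x' [y' [xx _ [x0 _]]]] := xy i.+1.
    by rewrite -xx // x0.
  by apply: Sc => n; have [x' [y' [_ yy [_ Sy]]]] := xy n; exists y'.
- by move=> y; split=> [Sy|[x []//]]; exists (fun=> 0%N).
- by move=> x x' y [-> _] [-> _].
Qed.

(** Countably many witnesses are interleaved along [pickle]; positions that code no pair are set to
    0 to keep the combined witness unique. *)
Lemma unique_closed_proj_bigcap (S : nat -> set (nat -> nat)) :
  (forall i, unique_closed_proj (S i)) ->
  unique_closed_proj [set y | forall i, S i y].
Proof.
move=> /choice[F HF].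
exists (fun x y => (forall i, F i (fun n => x (pickle (i, n))) y) /\
   forall k, (pickle_inv k : option (nat * nat)) = None -> x k = 0%N); split.
- move=> x y xy; split=> [i|k kN].
    have [Fc _ _] := HF i; apply: Fc => n.
    (* Large enough for the first [n] entries of the [i]-th witness to sit at positions at most [N],
       and for [y] to be controlled up to [n]. *)
    pose N := (\max_(j < n) pickle (i, nat_of_ord j) + n)%N.
    have [x' [y' [xx yy [Fi _]]]] := xy N.+1.
    exists (fun n => x' (pickle (i, n))), y'; split=> //.
      move=> j jn; apply: xx; rewrite ltnS /N.
      by apply: leq_trans (leq_addr _ _); apply: (leq_bigmax (Ordinal jn)).
    by apply: agree_le yy; rewrite ltnW // ltnS leq_addl.
  have [x' [y' [xx yy [_ x0]]]] := xy k.+1.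
  by rewrite -xx // x0.
- move=> y; split=> [Sy|[x [Fx _]] i]; last first.
    by have [_ -> _] := HF i; exists (fun n => x (pickle (i, n))).
  have /choice[x Fx] i : exists x, F i x y by have [_ <- _] := HF i.
  exists (fun k => if (pickle_inv k : option (nat * nat)) is Some (i, n) then x i n else 0%N).
  split=> [i|k ->//].
  by under eq_fun do rewrite pickleK_inv.
- move=> x x' y [Fx x0] [Fx' x0']; apply/funext => k.
  case E : (pickle_inv k : option (nat * nat)) => [[i n]|]; last by rewrite x0 // x0'.
  have := @pickle_invK (nat * nat)%type k; rewrite E /= => <-.
  have [_ _ Fu] := HF i.
  exact: (congr1 (fun f => f n) (Fu _ _ _ (Fx i) (Fx' i))).
Qed.

(** The first entry of the witness names the set that contains [y]; disjointness makes this entry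
    unique. *)
Lemma unique_closed_proj_bigcup (S : nat -> set (nat -> nat)) :
  (forall i, unique_closed_proj (S i)) ->
  (forall i j y, S i y -> S j y -> i = j) ->
  unique_closed_proj [set y | exists i, S i y].
Proof.
move=> /choice[F HF] Sdis.
exists (fun x y => F (x 0%N) (fun n => x n.+1) y); split.
- move=> x y xy; have [Fc _ _] := HF (x 0%N); apply: Fc => n.
  have [x' [y' [xx yy Fx]]] := xy n.+1.
  rewrite xx // in Fx; exists (fun n => x' n.+1), y'; split=> //.
    by move=> i ni; apply: xx.
  exact: agree_le yy.
- move=> y; split=> [[i Si]|[x Fx]].
    have [_ Sy _] := HF i; have [x Fx] := (Sy y).1 Si.
    by exists (fun n => if n is m.+1 then x m else i).
  by exists (x 0%N); have [_ -> _] := HF (x 0%N); exists (fun n => x n.+1).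
- move=> x x' y Fx Fx'.
  have x0 : x 0%N = x' 0%N.
    apply: (Sdis _ _ y).
      by have [_ -> _] := HF (x 0%N); exists (fun n => x n.+1).
    by have [_ -> _] := HF (x' 0%N); exists (fun n => x' n.+1).
  rewrite -x0 in Fx'; have [_ _ Fu] := HF (x 0%N).
  apply/funext => -[//|n].
  exact: (congr1 (fun f => f n) (Fu _ _ _ Fx Fx')).
Qed.

(** Complements are built in so that this class is a sigma-algebra. *)
Definition bi_unique_closed_proj (S : set (nat -> nat)) : Prop :=
  unique_closed_proj S /\ unique_closed_proj (~` S).

Lemma bi_unique_closed_proj_bigcup (S : nat -> set (nat -> nat)) :
  (forall i, bi_unique_closed_proj (S i)) ->
  bi_unique_closed_proj (\bigcup_i S i).
Proof.
move=> KS; split; last first.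
  rewrite (_ : ~` _ = [set y | forall i, (~` S i) y]).
    by apply: unique_closed_proj_bigcap => i; exact: (KS i).2.
  by rewrite setC_bigcup; apply/seteqP; split=> y /= Sy i; [exact: Sy|move=> _; exact: Sy].
(* Disjointification: the [i]-th piece of the union consists of the points whose first set is [S i].
   It is an intersection of sets and complements of the class. *)
pose D i j := if (j < i)%N then ~` S j else S i.
rewrite (_ : \bigcup_i _ = [set y | exists i, [set y | forall j, D i j y] y]).
  apply: unique_closed_proj_bigcup => [i|i j y /= Di Dj].
    apply: unique_closed_proj_bigcap => j; rewrite /D.
    by case: ifP => _; [exact: (KS j).2|exact: (KS i).1].
  have SD k : (forall j, D k j y) -> S k y by move=> /(_ k); rewrite /D ltnn.
  have [ij|ji|//] := ltngtP i j.
  - by have := Dj i; rewrite /D ij => /(_ (SD _ Di)).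
  - by have := Di j; rewrite /D ji => /(_ (SD _ Dj)).
apply/seteqP; split=> [y [i _ Si]|y [i /= /(_ i)]]; last first.
  by rewrite /D ltnn => Si; exists i.
have exi : exists i, `[<S i y>] by exists i; apply/asboolP.
exists (ex_minn exi); case: ex_minnP => m /asboolP Sm mmin j /=.
rewrite /D; case: ifP => // jm /asboolP /mmin; by rewrite leqNgt jm.
Qed.

(* Affine bijection of [0, 1) onto [1 - 2^-i, 1 - 2^-(i+1)); these intervals
   tile [0, 1). *)
Definition tile {R : realType} (i : nat) (t : R) : R :=
  1 - 2^-1 ^+ i * (1 - t / 2).

Lemma half_expr_gt0 {R : realType} i : 0 < (2^-1 : R) ^+ i.
Proof. by rewrite exprn_gt0 // invr_gt0. Qed.

Lemma half_expr_le {R : realType} i j :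
  (i <= j)%N -> (2^-1 : R) ^+ j <= 2^-1 ^+ i.
Proof. by move=> ij; apply: ler_wiXn2l => //; lra. Qed.

Lemma tile_le {R : realType} i (t u : R) : t <= u -> tile i t <= tile i u.
Proof.
rewrite /tile; have := half_expr_gt0 (R := R) i.
by move: (_ ^+ _) => h h0 tu; nra.
Qed.

Lemma tile_bounds {R : realType} i (t : R) : 0 <= t < 1 ->
  1 - 2^-1 ^+ i <= tile i t < 1 - 2^-1 ^+ i.+1.
Proof.
move=> /andP[t0 t1]; rewrite /tile exprS.
by have := half_expr_gt0 (R := R) i; move: (_ ^+ i) => h h0; apply/andP; split; nra.
Qed.

Lemma tile_disjoint {R : realType} i j (t u : R) :
  0 <= t < 1 -> 0 <= u < 1 -> tile i t = tile j u -> i = j.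
Proof.
move=> t01 u01 tu.
have := tile_bounds i t t01; have := tile_bounds j u u01.
rewrite -tu => /andP[j1 j2] /andP[i1 i2].
have [ij|ji|//] := ltngtP i j.
  by exfalso; have := half_expr_le (R := R) _ _ ij; lra.
by exfalso; have := half_expr_le (R := R) _ _ ji; lra.
Qed.

Lemma tile_inj {R : realType} i : injective (@tile R i).
Proof.
move=> t u; rewrite /tile => /addrI /oppr_inj.
by move/(mulfI (lt0r_neq0 (half_expr_gt0 i))); lra.
Qed.

Lemma half_expr_small {R : realType} (e : R) : 0 < e ->
  exists n, 2^-1 ^+ n < e.
Proof.
move=> e0; have := @cvg_expr R 2^-1.
rewrite ger0_norm ?invr_ge0 // => /(_ ltac:(lra)).
move=> /cvgrPdist_lt /(_ _ e0) [n _ /(_ n (leqnn n))] /=.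
by rewrite sub0r normrN ger0_norm ?(ltW (half_expr_gt0 _)) // => ?; exists n.
Qed.

Lemma tile_cover {R : realType} (b : R) : 0 <= b < 1 ->
  exists i t, 0 <= t < 1 /\ b = tile i t.
Proof.
move=> /andP[b0 b1].
have exi : exists i, b < 1 - 2^-1 ^+ i.+1.
  have [n] := half_expr_small (1 - b) ltac:(lra); exists n.
  by have := half_expr_le (R := R) _ _ (leqnSn n); lra.
case: (ex_minnP exi) => i bi imin.
have bi' : 1 - 2^-1 ^+ i <= b.
  case: i bi imin => [|i] bi imin; first by rewrite expr0; lra.
  by rewrite leNgt; apply/negP => /imin; rewrite ltnn.
exists i, (2 * (1 - (1 - b) * 2 ^+ i)); move: bi bi'.
have := half_expr_gt0 (R := R) i; rewrite /tile exprS.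
have e2 : (2^-1 ^+ i : R) * 2 ^+ i = 1 by rewrite -exprMn mulVf // expr1n.
have p2 : 0 < (2 : R) ^+ i by rewrite exprn_gt0.
move: e2 p2; move: (2 ^+ i) (2^-1 ^+ i) => p h hp p0 h0 h1 h2; split.
  apply/andP; split; nra.
nra.
Qed.

(** [g y] is the limit of the left endpoints of the nested tiles with addresses [y 0], [y 1], and so
    on. *)
Lemma baire_param (R : realType) : exists g : (nat -> nat) -> R,
  forall y, 0 <= g y < 1 /\ g y = tile (y 0%N) (g (fun n => y n.+1)).
Proof.
pose a := fix a n (y : nat -> nat) : R :=
  if n is m.+1 then tile (y 0%N) (a m (fun n => y n.+1)) else 0.
have a01 n y : 0 <= a n y < 1.
  elim: n y => [|n IH] y /=; first by rewrite lexx ltr01.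
  have := tile_bounds (y 0%N) _ (IH (fun n => y n.+1)).
  have := half_expr_gt0 (R := R) (y 0%N).+1.
  have := half_expr_le (R := R) _ _ (leq0n (y 0%N)).
  by rewrite expr0; lra.
have ainc n y : a n y <= a n.+1 y.
  elim: n y => [|n IH] y; first by have /andP[] := a01 1%N y.
  exact: (tile_le (y 0%N) _ _ (IH (fun n => y n.+1))).
have acvg y : cvgn (a ^~ y).
  apply: nondecreasing_is_cvgn; first exact/nondecreasing_seqP.
  by exists 1 => _ [n _ <-]; have /andP[_ /ltW] := a01 n y.
pose g y := limn (a ^~ y).
have gE y : g y = tile (y 0%N) (g (fun n => y n.+1)).
  apply: (@cvg_unique _ _ (a ^~ y @ \oo)) => //=.
  rewrite -(cvg_shiftS (a ^~ y)) /= /tile.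
  apply: cvgB; first exact: cvg_cst.
  apply: cvgMr; apply: cvgB; first exact: cvg_cst.
  by apply: cvgMl; exact: acvg.
exists g => y; split=> //.
have g01 y' : 0 <= g y' <= 1.
  apply/andP; split.
    by apply: limr_ge => //; apply: nearW => n; have /andP[] := a01 n y'.
  by apply: limr_le => //; apply: nearW => n; have /andP[_ /ltW] := a01 n y'.
have := g01 (fun n => y n.+1); have := g01 y.
(* The limit only gives [g <= 1]; unfolding one tile makes the upper bound strict. *)
rewrite [in X in _ -> _ -> X]gE /tile.
have := half_expr_gt0 (R := R) (y 0%N).
have := half_expr_le (R := R) _ _ (leq0n (y 0%N)); rewrite expr0.
by move: (_ ^+ _) (g _) => h u h1 h0 _ /andP[u0 u1]; apply/andP; split; nra.
Qed.

(** Every tile map contracts by at least one half, which gives continuity; disjointness of the tiles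
    gives injectivity, and reading off the successive tiles of [b] gives surjectivity. *)
Lemma baire_embedding (R : realType) : exists g : (nat -> nat) -> R,
  [/\ forall n y y', agree n y y' -> `|g y - g y'| <= 2^-1 ^+ n,
      injective g & forall b, 0 <= b < 1 -> exists y, g y = b].
Proof.
have [g gP] := baire_param R.
have g01 y : 0 <= g y < 1 by have [] := gP y.
have gE y : g y = tile (y 0%N) (g (fun n => y n.+1)) by have [] := gP y.
have contr n i (t u : R) : `|t - u| <= 2^-1 ^+ n ->
    `|tile i t - tile i u| <= 2^-1 ^+ n.+1.
  move=> tu; rewrite /tile.
  rewrite (_ : _ - _ = 2^-1 ^+ i * (2^-1 * (t - u))); last by field.
  rewrite !normrM exprS ger0_norm ?(ltW (half_expr_gt0 _))//.
  rewrite ger0_norm ?invr_ge0 //.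
  have := half_expr_le (R := R) _ _ (leq0n i); rewrite expr0.
  have := half_expr_gt0 (R := R) i; have := normr_ge0 (t - u).
  move: (2^-1 ^+ i) (2^-1 ^+ n) `|_| tu => a b c tu h1 h2 h3.
  by nra.
exists g; split.
- elim=> [|n IH] y y' yy'.
    have := g01 y; have := g01 y'; rewrite expr0 ler_norml; lra.
  rewrite (gE y) (gE y') (yy' 0%N) //; apply: contr; apply: IH => i ni.
  exact: yy'.
- move=> y y' yy'; apply/funext => n.
  elim: n y y' yy' => [|n IH] y y'; rewrite (gE y) (gE y') => yy'.
    exact: tile_disjoint yy'.
  have y0 : y 0%N = y' 0%N by exact: tile_disjoint yy'.
  rewrite y0 in yy'.
  exact: (IH (fun n => y n.+1) (fun n => y' n.+1) (tile_inj _ _ _ yy')).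
- pose S := {b : R | 0 <= b < 1}.
  have /choice[d dP] (b : S) : exists it : nat * S, val b = tile it.1 (val it.2).
    have [i [t [t01 bt]]] := tile_cover _ (valP b).
    by exists (i, exist _ t t01).
  pose s := fix s n (b : S) : nat := if n is m.+1 then s m (d b).2 else (d b).1.
  have close n (b : S) : `|g (s ^~ b) - val b| <= 2^-1 ^+ n.
    elim: n b => [|n IH] b.
      have := g01 (s ^~ b); have := valP b; rewrite expr0 ler_norml.
      move: (g _) (val b) => u v; lra.
    rewrite dP gE; exact: contr (IH (d b).2).
  move=> b b01; exists (s ^~ (exist _ b b01)).
  apply/eqP; rewrite -subr_eq0 -normr_le0; apply/ler_addgt0Pl => e e0.
  have [n ne] := half_expr_small e e0.
  rewrite addr0; apply: le_trans (ltW ne).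
  exact: (close n (exist _ b b01)).
Qed.

(** The sets whose preimage lies in the class form a sigma-algebra. It contains the open rays, whose
    preimages are open with closed complements. *)
Lemma bi_unique_closed_proj_preimage (R : realType) (g : (nat -> nat) -> R)
    (B : set R) :
  (forall n y y', agree n y y' -> `|g y - g y'| <= 2^-1 ^+ n) ->
  @measurable _ (measurableTypeR R) B -> bi_unique_closed_proj (g @^-1` B).
Proof.
move=> gc; rewrite measurable_realfun.RGenOInfty.measurableE => mB.
suff : <<s (@measurable_realfun.RGenOInfty.G R) >> `<=` [set B | bi_unique_closed_proj (g @^-1` B)].
  exact.
apply: smallest_sub.
  split=> /=.
  - rewrite preimage_set0; split.
      by apply: unique_closed_proj_closed => y /(_ 0%N)[? []].
    by apply: unique_closed_proj_closed => y _ [].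
  - by move=> A [A1 A2]; rewrite setTD preimage_setC; split=> //; rewrite setCK.
  - move=> A KA; rewrite preimage_bigcup.
    exact: bi_unique_closed_proj_bigcup.
move=> _ [a ->] /=.
have near y (e : R) : 0 < e -> exists n, forall y', agree n y' y -> `|g y' - g y| < e.
  move=> /half_expr_small[n ne]; exists n => y' /gc ?; exact: le_lt_trans ne.
split.
  apply: unique_closed_proj_open => y /=; rewrite in_itv /= andbT => ay.
  have [n nP] := near y (g y - a) ltac:(lra); exists n => y' /nP.
  by rewrite in_itv /= andbT ltr_norml; lra.
apply: unique_closed_proj_closed => y yP /=; rewrite in_itv /= andbT => ay.
have [n nP] := near y (g y - a) ltac:(lra); have [y' [/nP yy']] := yP n.
by apply; rewrite /= in_itv /= andbT; move: yy'; rewrite ltr_norml; lra.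
Qed.

(* Lusin-Souslin: a Borel set is a continuous injective image of a closed
   subset of Baire space; [w] is the inverse of that injection on [B]. *)
Lemma borel_code (R : realType) (B : set R) :
  @measurable _ (measurableTypeR R) B -> B `<=` `]0, 1[ ->
  exists w : R -> (nat -> nat),
    (forall e, 0 < e -> exists n, forall b b', B b -> B b' ->
      agree n (w b) (w b') -> `|b - b'| < e) /\
    (forall x, (forall n, exists2 b, B b & agree n (w b) x) ->
      exists2 b, B b & w b = x).
Proof.
move=> mB B01; have [g [gc ginj gsurj]] := baire_embedding R.
have [[F [Fcl FS Funiq]] _] := bi_unique_closed_proj_preimage R g B gc mB.
(* A code interleaves the witness of membership (even places) with the address of the point under
   [g] (odd places). *)
pose ev (x : nat -> nat) i := x i.*2; pose od (x : nat -> nat) i := x i.*2.+1.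
pose cod b x := F (ev x) (od x) /\ g (od x) = b.
have codu b x x' : cod b x -> cod b x' -> x = x'.
  move=> [Fx gx] [Fx' gx']; have oo : od x = od x' by apply: ginj; rewrite gx.
  have ee : ev x = ev x' by apply: Funiq Fx _; rewrite oo.
  apply/funext => i; rewrite -(odd_double_half i); case: (odd i).
    exact: (congr1 (fun f => f i./2) oo).
  exact: (congr1 (fun f => f i./2) ee).
have code b : exists x, B b -> cod b x.
  have [Bb|] := pselect (B b); last by exists (fun=> 0%N).
  have [y yb] : exists y, g y = b.
    by apply: gsurj; have := B01 _ Bb; rewrite /= in_itv /=; lra.
  have [x Fx] : exists x, F x y by apply/FS; rewrite /= yb.
  exists (fun i => if odd i then y i./2 else x i./2) => _; split.
    rewrite [X in F X](_ : _ = x); last first.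
      by apply/funext => i; rewrite /ev odd_double doubleK.
    rewrite [X in F _ X](_ : _ = y) //.
    by apply/funext => i; rewrite /od /= odd_double uphalf_double.
  rewrite (_ : od _ = y) //.
  by apply/funext => i; rewrite /od /= odd_double uphalf_double.
move/choice : code => [w wP]; exists w; split.
- move=> e /half_expr_small[n ne]; exists n.*2 => b b' Bb Bb' bb'.
  have [_ <-] := wP _ Bb; have [_ <-] := wP _ Bb'.
  apply: le_lt_trans ne; apply: gc => i ni; apply: bb'.
  by rewrite -doubleS leq_double.
- move=> x xP.
  have Fx : F (ev x) (od x).
    apply: Fcl => n; have [b Bb bx] := xP n.*2.
    have [Fb _] := wP _ Bb; exists (ev (w b)), (od (w b)); split=> // i ni.
      by apply: bx; rewrite ltn_double.
    by apply: bx; rewrite -doubleS leq_double.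
  have Bg : B (g (od x)) by apply/(FS (od x)); exists (ev x).
  by exists (g (od x)) => //; apply: codu (wP _ Bg) _.
Qed.

(** * The coin-tossing measure *)

(** The integer with binary digits [z 0], ..., [z (n - 1)], most significant first; it locates the
    cylinder as a dyadic interval of length [2^-n]. *)
Fixpoint cyl_index (z : cantor_space) (n : nat) : int :=
  if n is m.+1 then 2 * cyl_index z m + (z m)%:Z else 0.

Lemma floor_digit {R : realType} (t : R) n :
  Num.floor (2 ^+ n.+1 * t) = 2 * Num.floor (2 ^+ n * t) + (bin_digits t n)%:Z.
Proof.
apply: floor_def; rewrite /bin_digits exprS -mulrA.
have := floor_itv (2 ^+ n * t); rewrite !intrD intrM.
move: (Num.floor (2 ^+ n * t)) => k; move: (2 ^+ n * t) => x /andP[k1 k2].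
by case: (leP 1 (2 * x - 2 * k%:~R)) => /= ?; apply/andP; split; lra.
Qed.

Lemma bin_digits_cyl {R : realType} (t : R) z n :
  (0 <= t < 1 /\ cyl z n (bin_digits t)) <->
  Num.floor (2 ^+ n * t) = cyl_index z n.
Proof.
elim: n => [|n IH].
  rewrite expr0 mul1r /=; split=> [[t01 _]|/eqP].
    by apply: floor_def; rewrite add0r.
  by rewrite floor_eq add0r => t01; split=> // i.
rewrite floor_digit /=.
have -> : (0 <= t < 1 /\ cyl z n.+1 (bin_digits t)) <->
    Num.floor (2 ^+ n * t) = cyl_index z n /\ bin_digits t n = z n.
  have := agreeS n (bin_digits t) z.
  rewrite -/(cyl z n (bin_digits t)) -/(cyl z n.+1 (bin_digits t)); tauto.
move: (Num.floor (2 ^+ n * t)) (cyl_index z n) => k l.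
by split=> [[-> ->]//|]; case: (bin_digits t n); case: (z n) => /= kl; split=> //; lia.
Qed.

Definition coin_preimage {R : realType} (X : set cantor_space) : set R :=
  [set t | 0 <= t < 1 /\ X (bin_digits t)].

Definition coin_measurable (R : realType) (X : set cantor_space) : Prop :=
  @measurable _ (measurableTypeR R) (@coin_preimage R X).

Lemma coin_preimage_cyl {R : realType} z n :
  coin_preimage (cyl z n) = [set` `[(2^-1 ^+ n * (cyl_index z n)%:~R : R),
     2^-1 ^+ n * (cyl_index z n + 1)%:~R[].
Proof.
have scale (k l t : R) :
    (2^-1 ^+ n * k <= t < 2^-1 ^+ n * l) = (k <= 2 ^+ n * t < l).
  by rewrite exprVn ler_pdivrMl ?ltr_pdivlMl ?exprn_gt0.
apply/seteqP; split=> t; rewrite /= in_itv /= scale -floor_eq.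
  by move=> /bin_digits_cyl ->.
by move=> /eqP; rewrite -bin_digits_cyl.
Qed.

Lemma coin_measurable_cyl (R : realType) z n : coin_measurable R (cyl z n).
Proof. by rewrite /coin_measurable coin_preimage_cyl; exact: measurable_itv. Qed.

Lemma coin_mu_cyl {R : realType} z n : @coin_mu R (cyl z n) = (2^-1 ^+ n)%:E.
Proof.
rewrite /coin_mu -/(coin_preimage (cyl z n)) coin_preimage_cyl lebesgue_measure_itv /=.
rewrite lte_fin intrD mulrDr mulr1 ltrDl half_expr_gt0 -EFinD; congr (_%:E); ring.
Qed.

Definition set_digit (z : cantor_space) (n : nat) (b : bool) : cantor_space :=
  fun i => if i == n then b else z i.

Lemma set_digit_eq z n b : set_digit z n b n = b.
Proof. by rewrite /set_digit eqxx. Qed.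

Lemma agree_set_digit z n b : agree n (set_digit z n b) z.
Proof. by move=> i ni; rewrite /set_digit ltn_eqF. Qed.

Lemma cyl_set_digit z n b : cyl (set_digit z n b) n.+1 = cyl z n `&` [set x | x n = b].
Proof.
apply/seteqP; split=> x.
  move/agreeS => [xz]; rewrite set_digit_eq; split=> //.
  by apply: agree_trans (agree_set_digit z n b).
move=> [xz xn]; apply/agreeS; rewrite set_digit_eq; split=> //.
by apply: agree_trans xz _; apply: agree_sym; exact: agree_set_digit.
Qed.

Lemma coin_preimageI {R : realType} (X Y : set cantor_space) :
  @coin_preimage R (X `&` Y) = coin_preimage X `&` coin_preimage Y.
Proof. by apply/seteqP; split=> t /=; [case=> ? []|case=> -[? ?] []]. Qed.

Lemma coin_preimageU {R : realType} (X Y : set cantor_space) :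
  @coin_preimage R (X `|` Y) = coin_preimage X `|` coin_preimage Y.
Proof.
apply/seteqP; split=> t /=; first by case=> ? []; [left|right].
by case=> -[? ?]; split=> //; [left|right].
Qed.

Lemma coin_measurableI R X Y :
  coin_measurable R X -> coin_measurable R Y -> coin_measurable R (X `&` Y).
Proof. by rewrite /coin_measurable coin_preimageI; exact: measurableI. Qed.

Lemma cyl_split X z n : X `&` cyl z n =
  (X `&` cyl (set_digit z n false) n.+1) `|` (X `&` cyl (set_digit z n true) n.+1).
Proof.
rewrite !cyl_set_digit -setIUr -setIUr; congr (_ `&` _).
apply/seteqP; split=> x; last by case.
by move=> xz; split=> //=; case: (x n); [right|left].
Qed.

(** Cylinders are split down to length [n], where each one is either contained in [X] or disjoint
    from it. *)
Lemma coin_measurable_determined (R : realType) n (X : set cantor_space) :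
  (forall z z', agree n z z' -> X z -> X z') -> coin_measurable R X.
Proof.
move=> Xn; suff H j m z : (m + j = n)%N -> coin_measurable R (X `&` cyl z m).
  have := H n 0%N (fun=> false) erefl; rewrite (_ : X `&` _ = X) //.
  by apply/seteqP; split=> x; [move=> []|split].
elim: j m z => [|j IH] m z.
  rewrite addn0 => ->; have [Xz|Xz] := pselect (X z).
    rewrite setIidr; first exact: coin_measurable_cyl.
    by move=> x xz; apply: Xn Xz; exact: agree_sym.
  rewrite (_ : _ `&` _ = set0).
    rewrite /coin_measurable (_ : coin_preimage _ = set0) ?measurable0 //.
    by apply/seteqP; split=> x // [].
  by apply/seteqP; split=> x // [Xx xz]; apply: Xz; apply: Xn Xx.
rewrite addnS -addSn => mjn.
by rewrite cyl_split /coin_measurable coin_preimageU; apply: measurableU; exact: IH.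
Qed.

Lemma coin_measurable_exists (R : realType) (P : nat -> set cantor_space) :
  (forall n z z', agree n z z' -> P n z -> P n z') ->
  coin_measurable R [set z | exists n, P n z].
Proof.
move=> PP; rewrite /coin_measurable.
rewrite (_ : coin_preimage _ = \bigcup_n @coin_preimage R (P n)).
  apply: bigcup_measurable => n _.
  by apply: (coin_measurable_determined R n) => z z' /PP; apply.
apply/seteqP; split=> [t [t01 [n Pn]]|t [n _ [t01 Pn]]]; first by exists n.
by split=> //; exists n.
Qed.

Lemma coin_measurableC R X : coin_measurable R X -> coin_measurable R (~` X).
Proof.
rewrite /coin_measurable => mX.
rewrite (_ : coin_preimage _ = `[0%R, 1%R[%classic `\` coin_preimage X).
  by apply: measurableD => //; exact: measurable_itv.
apply/seteqP; split=> t /=; rewrite in_itv /=.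
  by move=> [t01 Xt]; split=> // -[_].
by move=> [t01 Xt]; split=> // Xt'; apply: Xt.
Qed.

(** * Density ratios on cylinders *)

Definition density_ratio {R : realType} (X : set cantor_space) z n : R :=
  fine (coin_mu (X `&` cyl z n)) / fine (@coin_mu R (cyl z n)).

Lemma coin_mu_le_cyl {R : realType} X z n : coin_measurable R X ->
  (0 <= @coin_mu R (X `&` cyl z n) <= (2^-1 ^+ n)%:E)%E.
Proof.
move=> mX; rewrite measure_ge0 /= -(coin_mu_cyl z).
apply: le_measure; rewrite ?inE.
- exact: (coin_measurableI _ _ _ mX (coin_measurable_cyl R z n)).
- exact: coin_measurable_cyl.
- by move=> t [? []].
Qed.

Lemma coin_mu_fin_num {R : realType} X z n : coin_measurable R X ->
  @coin_mu R (X `&` cyl z n) \is a fin_num.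
Proof.
move=> mX; have /andP[l u] := @coin_mu_le_cyl R X z n mX.
by rewrite fin_real // (lt_le_trans _ l) ?ltNy0 //= (le_lt_trans u) ?ltry.
Qed.

Lemma density_ratio_bounds {R : realType} X z n : coin_measurable R X ->
  0 <= (density_ratio X z n : R) <= 1.
Proof.
move=> mX; have /andP[l u] := @coin_mu_le_cyl R X z n mX.
rewrite /density_ratio coin_mu_cyl /=; apply/andP; split.
  by apply: divr_ge0; [exact: fine_ge0|exact: ltW (half_expr_gt0 _)].
rewrite ler_pdivrMr ?half_expr_gt0 // mul1r -lee_fin fineK //.
exact: coin_mu_fin_num.
Qed.

(** Additivity of the measure on the two halves of a cylinder: the density ratios form a
    martingale. *)
Lemma density_ratio_split {R : realType} X z n : coin_measurable R X ->
  density_ratio X z n = (density_ratio X (set_digit z n false) n.+1 +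
    density_ratio X (set_digit z n true) n.+1) / 2 :> R.
Proof.
move=> mX; rewrite /density_ratio !coin_mu_cyl /= {1}cyl_split.
rewrite {1}/coin_mu -/(coin_preimage _) coin_preimageU measureU.
- rewrite fineD ?coin_mu_fin_num // exprS invfM invrK.
  by rewrite -mulrDl -/(coin_mu _) -/(coin_mu _); field; exact: lt0r_neq0 (half_expr_gt0 _).
- exact: (coin_measurableI _ _ _ mX (coin_measurable_cyl R _ n.+1)).
- exact: (coin_measurableI _ _ _ mX (coin_measurable_cyl R _ n.+1)).
rewrite !cyl_set_digit; apply/seteqP; split=> // t /= [[_ [_ [_ /= f]]] [_ [_ [_]]]].
by rewrite /= f.
Qed.

Lemma density_ratio1 {R : realType} X z n :
  cyl z n `<=` X -> density_ratio X z n = 1 :> R.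
Proof.
by move=> zX; rewrite /density_ratio setIidr // coin_mu_cyl /= divff.
Qed.

Lemma density_ratio0 {R : realType} X z n :
  cyl z n `<=` ~` X -> density_ratio X z n = 0 :> R.
Proof.
move=> zX; rewrite /density_ratio (_ : _ `&` _ = set0).
  rewrite {1}/coin_mu (_ : [set _ | _] = set0) ?measure0 /= ?mul0r //.
  by apply/seteqP; split=> // t [].
by apply/seteqP; split=> // x [Xx /zX].
Qed.

Lemma cantor_nbhs_cyl z n : nbhs z (cyl z n).
Proof.
elim: n => [|n IH]; first by apply: filterS (@filterT _ (nbhs z) _) => x _ i.
have zn : nbhs z [set x : cantor_space | x n = z n].
  have := @proj_continuous nat (fun _ => bool) n z [set z n] (discrete_set1 _).
  exact.
by apply: filterS (filterI IH zn) => x [xz xn]; apply/agreeS.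
Qed.

Lemma cantor_open_exists (P : nat -> set cantor_space) :
  (forall n z z', agree n z z' -> P n z -> P n z') ->
  open [set z | exists n, P n z].
Proof.
move=> PP; rewrite openE => z [n Pn]; rewrite /interior.
apply: filterS (cantor_nbhs_cyl z n) => x xz; exists n.
by apply: PP Pn; exact: agree_sym.
Qed.

(** * Moving a dyadic density *)

(** Dyadic values are required because the exponent [m] counts the steps within which a [Final] node
    reaches 0 or 1. *)
Definition dyadic {R : realType} (v : R) : Prop :=
  exists m : nat, 2 ^+ m * v \is a Num.int.

Lemma dyadicB {R : realType} (u v : R) : dyadic u -> dyadic v -> dyadic (u - v).
Proof.
move=> [m um] [n vn]; exists (m + n)%N; rewrite exprD mulrBr.
by rewrite -mulrA mulrCA [X in _ - X]mulrAC -mulrA rpredB // rpredM // ?rpredX ?rpred_nat // mulrC.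
Qed.

Lemma dyadicM {R : realType} (u v : R) : dyadic u -> dyadic v -> dyadic (u * v).
Proof.
move=> [m um] [n vn]; exists (m + n)%N; rewrite exprD.
by rewrite mulrACA rpredM.
Qed.

Lemma dyadic_nat {R : realType} n : dyadic (n%:R : R).
Proof. by exists 0%N; rewrite expr0 mul1r rpred_nat. Qed.

Lemma dyadic_half {R : realType} : dyadic (1 / 2 : R).
Proof. by exists 1%N; rewrite expr1 mulrC divfK ?rpred1. Qed.

Definition dyadic_approx {R : realType} (n : nat) (p : R) : R :=
  (Num.floor (2 ^+ n * p))%:~R / 2 ^+ n.

Lemma dyadic_dyadic_approx {R : realType} n (p : R) : dyadic (dyadic_approx n p).
Proof. by exists n; rewrite mulrC divfK ?intr_int // expf_neq0. Qed.

Lemma dyadic_approx_bounds {R : realType} n (p : R) :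
  p - 2^-1 ^+ n <= dyadic_approx n p <= p.
Proof.
have e0 : (0 : R) < 2 ^+ n by rewrite exprn_gt0.
have /andP[f1 f2] := floor_itv (2 ^+ n * p).
rewrite /dyadic_approx ler_pdivlMr // ler_pdivrMr // mulrBl exprVn mulVf ?gt_eqF //.
by move: f1 f2; rewrite intrD mulrC; lra.
Qed.

Lemma dyadic_approx01 {R : realType} n (p : R) : 0 < p < 1 ->
  0 <= dyadic_approx n p < 1.
Proof.
move=> /andP[p0 p1]; have /andP[_ u] := dyadic_approx_bounds n p.
rewrite (le_lt_trans u p1) andbT divr_ge0 ?exprn_ge0 // ler0z floor_ge0.
by rewrite mulr_ge0 ?exprn_ge0 // ltW.
Qed.

(* One move of the value [v] towards the target [t]: the factor [min v (1 - v)]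
   keeps the sibling value [2 v - step v t] inside [0, 1]. *)
Definition step {R : realType} (v t : R) : R := v + Num.min v (1 - v) * (t - v).

Lemma dyadic_step {R : realType} (v t : R) : dyadic v -> dyadic t -> dyadic (step v t).
Proof.
move=> dv dt; rewrite /step -[_ * _]opprK; apply: dyadicB => //.
rewrite -sub0r; apply: dyadicB; first exact: (dyadic_nat 0).
apply: dyadicM; last exact: dyadicB.
by rewrite /Num.min; case: ifP => // _; apply: dyadicB => //; exact: (dyadic_nat 1).
Qed.

Lemma step_bounds {R : realType} (v t : R) : 0 < v < 1 -> 0 <= t < 1 ->
  0 < step v t < 1 /\ 0 <= 2 * v - step v t <= 1.
Proof.
move=> /andP[v0 v1] /andP[t0 t1]; rewrite /step.
by case: (leP v (1 - v)) => h; split; apply/andP; split; nra.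
Qed.

(** Each step is a convex combination of value and target. Once the targets are near [b], the values
    stay away from 0 and 1, so the weight of the target is bounded below and the old error decays
    geometrically. *)
Lemma step_cvg {R : realType} (u t : nat -> R) (b : R) :
  0 < b < 1 -> 0 < u 0%N < 1 -> (forall n, 0 <= t n < 1) ->
  (forall n, u n.+1 = step (u n) (t n)) ->
  t @ \oo --> b -> u @ \oo --> b.
Proof.
move=> /andP[b0 b1] u0 t01 uS /cvgrPdist_le tb; apply/cvgrPdist_le => e e0.
have u01 n : 0 < u n < 1.
  by elim: n => // n IH; rewrite uS; have [] := step_bounds _ _ IH (t01 n).
(* The first bound leaves [e / 2] for the geometric term; the other two keep every target within [d]
   of [b] inside the interval from [d] to [1 - d]. *)
pose d := Num.min (e / 2) (Num.min (b / 2) ((1 - b) / 2)).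
have d0 : 0 < d by rewrite /d !lt_min !divr_gt0 // subr_gt0.
have de : d <= e / 2 by rewrite /d ge_min lexx.
have db : d <= b / 2 by rewrite /d !ge_min lexx orbT.
have db1 : d <= (1 - b) / 2 by rewrite /d !ge_min lexx !orbT.
have [N _ tN] := tb d d0.
pose c := Num.min d (Num.min (u N) (1 - u N)).
have /andP[uN0 uN1] := u01 N.
have c0 : 0 < c by rewrite lt_min d0 lt_min uN0 subr_gt0.
have cd : c <= d by rewrite /c ge_min lexx.
have cu : c <= u N by rewrite /c !ge_min lexx orbT.
have cu1 : c <= 1 - u N by rewrite /c !ge_min lexx !orbT.
have inv j : [/\ c <= u (N + j)%N, u (N + j)%N <= 1 - c &
    `|b - u (N + j)%N| <= d + (1 - c) ^+ j].
  elim: j => [|j [h1 h2 h3]].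
    rewrite addn0 expr0 ler_norml; split; [lra|lra|apply/andP; split; lra].
  have := tN (N + j)%N (leq_addr _ _) => /=; rewrite ler_norml => /andP[t1 t2].
  have p0 : 0 <= (1 - c) ^+ j by rewrite exprn_ge0 //; lra.
  rewrite addnS uS exprS /step; move: h3; rewrite ler_norml => /andP[h3 h4].
  move: (u (N + j)%N) (t (N + j)%N) (_ ^+ _) h1 h2 h3 h4 t1 t2 p0 => v s p h1 h2 h3 h4 t1 t2 p0.
  (* With weight [l] in place of the minimum, the new value is [(1 - l) * v + l * s]; the products
     below are the inequalities whose sums [lra] needs. *)
  have [l [l1 l2 ->]] : exists l, [/\ c <= l, l <= 1 / 2 & Num.min v (1 - v) = l].
    by exists (Num.min v (1 - v)); case: (leP v (1 - v)) => ?; split=> //; lra.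
  have lp : 0 <= (l - c) * p by rewrite mulr_ge0 ?subr_ge0.
  have a1 : 0 <= (1 - l) * (v - c) by rewrite mulr_ge0 //; lra.
  have a2 : 0 <= l * (s - c) by rewrite mulr_ge0 //; lra.
  have a3 : 0 <= (1 - l) * (1 - c - v) by rewrite mulr_ge0 //; lra.
  have a4 : 0 <= l * (1 - c - s) by rewrite mulr_ge0 //; lra.
  have a5 : 0 <= (1 - l) * (d + p - (b - v)) by rewrite mulr_ge0 //; lra.
  have a6 : 0 <= l * (d - (b - s)) by rewrite mulr_ge0 //; lra.
  have a7 : 0 <= (1 - l) * (d + p + (b - v)) by rewrite mulr_ge0 //; lra.
  have a8 : 0 <= l * (d + (b - s)) by rewrite mulr_ge0 //; lra.
  rewrite ler_norml; split; [lra|lra|apply/andP; split; lra].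
have : ((1 - c) ^+ n @[n --> \oo] --> (0 : R)).
  by apply: cvg_expr; rewrite ger0_norm; lra.
move/cvgrPdist_le => /(_ (e / 2) ltac:(lra)) [M _ cM].
exists (N + M)%N => // n /= /subnKC <-.
rewrite -addnA; have [_ _ h] := inv (M + (n - (N + M)))%N.
apply: le_trans h _.
have := cM (M + (n - (N + M)))%N (leq_addr _ _).
rewrite /= sub0r normrN ler_norml; lra.
Qed.

(** * The martingale *)

Section Automaton.
Variables (R : realType) (B : set R) (w : R -> nat -> nat).

(* [b] leaves the code of [p] at position [m], through the digit [w b m];
   the pair is numbered by [k]. *)
Definition splits (k : nat) (p b : R) : Prop :=
  exists m, [/\ agree m (w b) (w p), w b m <> w p m & pickle (m, w b m) = k].

Definition split_pos (k : nat) : nat :=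
  if (unpickle k : option (nat * nat)) is Some (m, _) then m else 0%N.

(* The points of [B] still reachable from the node with designated point [p]
   once the first [k] exits have been refused. *)
Definition reach (p : R) (l k : nat) (b : R) : Prop :=
  [/\ B b, agree l (w b) (w p) & forall k', (k' < k)%N -> ~ splits k' p b].

(* The first component of [Final], [Branch] and [Move] is the density at the node.
   [Final] nodes run to density 0 or 1 in finitely many steps; at a [Branch] node the
   digit 1 takes exit [k]; at a [Move] node the digit 1 is sacrificed to bring the density
   at the other child closer to the designated point. *)
Inductive state :=
| Start | Final of R | Branch of R & R & nat & nat | Move of R & R & nat & nat.

Definition dens (s : state) : R :=
  match s with
  | Start => 1 / 2 | Final v => v | Branch v _ _ _ => v | Move v _ _ _ => v
  end.

Definition exits (p : R) (l k : nat) : set R := [set b | reach p l k b /\ splits k p b].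

(** The two children always average to the density of the parent. At [Final], one child becomes 0 or
    1 and the other loses a binary digit. At [Move], the time [n] sets the precision of the target,
    so that the targets stay dyadic and yet approach the designated points. *)
Definition next (n : nat) (s : state) (d : bool) : state :=
  match s with
  | Start => if d && `[< B !=set0 >] then Branch (1 / 2) (xget 0 B) 0%N 0%N
             else Final (1 / 2)
  | Final v => Final (if v <= 1 / 2 then (if d then 0 else 2 * v)
                      else (if d then 1 else 2 * v - 1))
  | Branch v p l k =>
      if ~~ d then Move v p l k.+1
      else if `[< exits p l k !=set0 >]
           then Move v (xget 0 (exits p l k)) (split_pos k).+1 0%N
           else Final v
  | Move v p l k =>
      let v' := step v (dyadic_approx n p) in
      if d then Final (2 * v - v') else Branch v' p l k
  end.

Fixpoint run (z : cantor_space) (n : nat) : state :=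
  if n is m.+1 then next m (run z m) (z m) else Start.

Lemma runS z n : run z n.+1 = next n (run z n) (z n).
Proof. by []. Qed.

Lemma run_agree n z z' : agree n z z' -> run z n = run z' n.
Proof. by elim: n => //= n IH /agreeS[/IH -> ->]. Qed.

Definition reachable (s : state) (b : R) : Prop :=
  match s with
  | Start => B b | Final _ => False | Branch _ p l k => reach p l k b
  | Move _ p l k => reach p l k b
  end.

Definition direction (s : state) (b : R) : bool :=
  match s with
  | Start => true | Branch _ p _ k => `[< splits k p b >] | _ => false
  end.

(** * Exits and the points reachable at a node *)

Lemma splits_pos k p b : splits k p b ->
  agree (split_pos k) (w b) (w p) /\ w b (split_pos k) <> w p (split_pos k).
Proof. by move=> [m [bp bpm <-]]; rewrite /split_pos pickleK. Qed.

Lemma splits_fun k k' p b : splits k p b -> splits k' p b -> k = k'.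
Proof.
move=> [m [bp bpm <-]] [m' [bp' bpm' <-]].
suff -> : m = m' by [].
have [mm|mm|//] := ltngtP m m'; first by case: bpm; exact: bp'.
by case: bpm'; exact: bp.
Qed.

Lemma splits_agree k p b b' : splits k p b -> splits k p b' ->
  agree (split_pos k).+1 (w b) (w b').
Proof.
move=> [m [bp bpm <-]] [m' [bp' bpm' /(pcan_inj pickleK)[e]]].
rewrite /split_pos pickleK => bb'; subst m'; apply/agreeS; split=> //.
exact: agree_trans (agree_sym _ _ _ bp').
Qed.

Lemma agree_splits k p b b' : splits k p b -> agree (split_pos k).+1 (w b') (w b) ->
  splits k p b'.
Proof.
move=> [m [bp bpm <-]]; rewrite /split_pos pickleK => /agreeS[bb bbm].
by exists m; rewrite bbm; split=> //; exact: agree_trans bp.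
Qed.

Lemma reach_self p l k : B p -> reach p l k p.
Proof. by move=> Bp; split=> // k' _ [m []]. Qed.

Lemma exits_level p l k b : exits p l k b -> (l <= split_pos k)%N.
Proof.
move=> [[_ bp _] /splits_pos[_ ne]]; rewrite leqNgt; apply/negP => /bp.
exact: ne.
Qed.

Lemma exitsP p l k : exits p l k !=set0 -> exits p l k (xget 0 (exits p l k)).
Proof. by move=> [b eb]; exact: xgetI eb. Qed.

(** Changing the designated point loses nothing: leaving [p] through exit [k] amounts to agreeing
    with the chosen point up to and including [split_pos k]. Since a point leaves [p] through one
    exit only, the earlier refusals then hold automatically. *)
Lemma reach_exit p l k b : exits p l k !=set0 ->
  reach (xget 0 (exits p l k)) (split_pos k).+1 0%N b <-> exits p l k b.
Proof.
move=> /exitsP; move: (xget _ _) => q eq.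
have lk := exits_level _ _ _ _ eq; have [[Bq qp qk] sq] := eq.
split=> [[Bb bq _]|[[Bb bp bk] sb]]; last first.
  by split=> //; exact: splits_agree sb sq.
have sb := agree_splits _ _ _ _ sq bq; split=> //; split=> //.
  apply: agree_trans qp; apply: agree_le bq; exact: leqW.
by move=> k' k'k /(splits_fun _ _ _ _ sb) kk; rewrite kk ltnn in k'k.
Qed.

(** Hence the points at a node are partitioned between its children, and each point of [B]
    determines exactly one branch. *)
Lemma reachable_next n s d b :
  reachable (next n s d) b <-> reachable s b /\ direction s b = d.
Proof.
case: s => [|v|v p l k|v p l k] /=.
- case: d => /=; last by split=> // -[].
  case: asboolP => [B0|nB] /=; last first.
    by split=> // -[Bb _]; apply: nB; exists b.
  by split=> [[Bb _ _]|[Bb _]]; split.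
- by split=> // -[].
- case: d => /=.
    case: asboolP => [ne|ne] /=.
      split=> [/(reach_exit _ _ _ _ ne)[rb sb]|[rb /asboolP sb]].
        by split=> //; exact/asboolP.
      by apply/(reach_exit _ _ _ _ ne).
    by split=> // -[rb /asboolP sb]; apply: ne; exists b.
  split=> [[Bb bp bk]|[[Bb bp bk] /asboolP sb]].
    split; last by apply/asboolPn; exact: bk.
    by split=> // k' k'k; apply: bk; exact: ltnW.
  by split=> // k'; rewrite ltnS leq_eqVlt => /predU1P[->//|/bk].
- by case: d => /=; split=> // -[].
Qed.

Lemma reachable_run_le z m n b : (m <= n)%N ->
  reachable (run z n) b -> reachable (run z m) b.
Proof.
move=> /subnKC <-; elim: (n - m)%N => [|j IH]; first by rewrite addn0.
by rewrite addnS => /reachable_next[/IH].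
Qed.

Lemma exists_path b : B b -> exists z, forall n, reachable (run z n) b.
Proof.
move=> Bb; pose s := fix s n := if n is m.+1 then next m (s m) (direction (s m) b) else Start.
exists (fun n => direction (s n) b) => n.
suff -> : run (fun n => direction (s n) b) n = s n.
  by elim: n => //= n IH; apply/reachable_next.
by elim: n => //= n ->.
Qed.

Lemma path_inj z z' b : (forall n, reachable (run z n) b) ->
  (forall n, reachable (run z' n) b) -> z = z'.
Proof.
move=> zb zb'; apply: agree_ext; elim=> // n IH; apply/agreeS; split=> //.
have /(reachable_next n (run z n) (z n))[_ <-] := zb n.+1.
have /(reachable_next n (run z' n) (z' n))[_ <-] := zb' n.+1.
by rewrite (run_agree _ _ _ IH).
Qed.

(** * Live branches and the points of [B] *)

Definition live (z : cantor_space) : Prop := forall n v, run z n <> Final v.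

(* Junk values on [Start] and [Final]. *)
Definition point (s : state) : R :=
  match s with Branch _ p _ _ => p | Move _ p _ _ => p | _ => 0 end.
Definition level (s : state) : nat :=
  match s with Branch _ _ l _ => l | Move _ _ l _ => l | _ => 0%N end.
Definition refused (s : state) : nat :=
  match s with Branch _ _ _ k => k | Move _ _ _ k => k | _ => 0%N end.

(** [Start] occupies time 0, so along a live branch the [Branch] nodes fall at odd times and the
    [Move] nodes at positive even times. *)
Lemma live_Branch z j : live z -> exists v p l k, run z j.*2.+1 = Branch v p l k.
Proof.
move=> zl; elim: j => [|j [v [p [l [k IH]]]]].
  have := zl 1%N; rewrite /=; case: ifP => [_ _|_ /(_ (1 / 2))//].
  by do 4!eexists.
have := zl j.*2.+2; have := zl j.+1.*2.+1; rewrite doubleS (runS z j.*2.+2) (runS z j.*2.+1) IH /=.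
case: (z j.*2.+1) => /=; last first.
  by case: (z j.*2.+2) => [/(_ _ erefl)//|_ _]; do 4!eexists.
case: ifP => _ /=; last by move=> _ /(_ v).
by case: (z j.*2.+2) => [/(_ _ erefl)//|_ _]; do 4!eexists.
Qed.

Lemma live_Move z j : live z -> exists v p l k, run z j.*2.+2 = Move v p l k.
Proof.
move=> zl; have [v [p [l [k bj]]]] := live_Branch z j zl.
have := zl j.*2.+2; rewrite (runS z j.*2.+1) bj /=.
case: ifP => _; first by do 4!eexists.
by case: ifP => _; [do 4!eexists|move=> /(_ v)].
Qed.

Lemma live_Move_digit z j : live z -> z j.*2.+2 = false.
Proof.
move=> zl; have [v [p [l [k mj]]]] := live_Move z j zl.
by have := zl j.*2.+3; rewrite (runS z j.*2.+2) mj /=; case: (z _) => // /(_ _ erefl).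
Qed.

Lemma live_Branch_next z j v p l k : live z -> run z j.*2.+1 = Branch v p l k ->
  exists q l' k', [/\ run z j.*2.+2 = Move v q l' k',
    run z j.+1.*2.+1 = Branch (step v (dyadic_approx j.*2.+2 q)) q l' k' &
    if z j.*2.+1 then [/\ exits p l k q, (l < l')%N & k' = 0%N]
    else [/\ q = p, l' = l & k' = k.+1]].
Proof.
move=> zl bj; have zm := live_Move_digit z j zl; have := zl j.*2.+2.
rewrite doubleS (runS z j.*2.+2) (runS z j.*2.+1) zm bj /=.
case: (z j.*2.+1) => /=; last by move=> _; exists p, l, k.+1.
case: asboolP => [/exitsP ne _|_ /(_ v)//].
exists (xget 0 (exits p l k)), (split_pos k).+1, 0%N; split=> //; split=> //.
by rewrite ltnS; exact: exits_level ne.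
Qed.

Lemma live_point z n : live z -> (0 < n)%N -> B (point (run z n)).
Proof.
move=> zl.
have H j : B (point (run z j.*2.+1)).
  elim: j => [|j IH].
    have := zl 1%N; rewrite /=; case: ifP => [/andP[_ /asboolP [b Bb]] _|_ /(_ (1 / 2))//].
    exact: xgetI Bb.
  have [v [p [l [k bj]]]] := live_Branch z j zl.
  have [q [l' [k' [_ ->]]]] := live_Branch_next z j v p l k zl bj.
  rewrite bj /= in IH *; case: ifP => _; first by move=> [[[]]].
  by move=> [->].
(* A [Move] node has the designated point of the [Branch] node that follows it. *)
case: n => // n _; rewrite -(odd_double_half n); case: (odd n); last exact: H.
have [v [p [l [k bj]]]] := live_Branch z n./2 zl.
have [q [l' [k' [mj bj' _]]]] := live_Branch_next z n./2 v p l k zl bj.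
by have := H (n./2).+1; rewrite add1n mj bj'.
Qed.

Lemma live_reachable_point z n : live z -> (0 < n)%N ->
  reachable (run z n) (point (run z n)).
Proof.
move=> zl n0; case: n n0 => // n _; have := live_point z n.+1 zl erefl.
rewrite -(odd_double_half n); case: (odd n).
  have [v [p [l [k ->]]]] := live_Move z n./2 zl; exact: reach_self.
have [v [p [l [k ->]]]] := live_Branch z n./2 zl; exact: reach_self.
Qed.

Lemma reachable_agree s b : reachable s b -> agree (level s) (w b) (w (point s)).
Proof. by case: s => // [v p l k|v p l k] []. Qed.

Lemma reachable_live z b : (forall n, reachable (run z n) b) -> live z.
Proof. by move=> zb n v e; have := zb n; rewrite e. Qed.

Hypothesis wcont : forall e, 0 < e -> exists n, forall b b', B b -> B b' ->
  agree n (w b) (w b') -> `|b - b'| < e.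
Hypothesis wclosed : forall x, (forall n, exists2 b, B b & agree n (w b) x) ->
  exists2 b, B b & w b = x.

Definition jumps_forever (z : cantor_space) : Prop :=
  forall N, exists2 j, (N <= j)%N & z j.*2.+1 = true.

Lemma level_mono z i j : live z -> (i <= j)%N ->
  (level (run z i.*2.+1) <= level (run z j.*2.+1))%N.
Proof.
move=> zl /subnKC <-; elim: (j - i)%N => [|d IH]; first by rewrite addn0.
apply: leq_trans IH _; rewrite addnS.
have [v [p [l [k bj]]]] := live_Branch z (i + d) zl.
have [q [l' [k' [_ -> ]]]] := live_Branch_next z (i + d) v p l k zl bj.
by rewrite bj /=; case: ifP => _ [_]; [move=> /ltnW|move=> ->].
Qed.

(** Every jump raises the level by at least one and resets the count of refusals. *)
Lemma level_unbounded z m : live z -> jumps_forever z ->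
  exists2 j, (m <= level (run z j.*2.+1))%N & refused (run z j.*2.+1) = 0%N.
Proof.
move=> zl zj; elim: m => [|m [i mi _]].
  have [j _ zj1] := zj 0%N; exists j.+1 => //.
  have [v [p [l [k bj]]]] := live_Branch z j zl.
  have [q [l' [k' [_ -> ]]]] := live_Branch_next z j v p l k zl bj.
  by rewrite zj1 => -[].
have [j ij zj1] := zj i; exists j.+1.
  have := level_mono z i j zl ij.
  have [v [p [l [k bj]]]] := live_Branch z j zl.
  have [q [l' [k' [_ -> ]]]] := live_Branch_next z j v p l k zl bj.
  by rewrite zj1 bj /= => -[_ ll' _] il; apply: leq_ltn_trans ll'; exact: leq_trans il.
have [v [p [l [k bj]]]] := live_Branch z j zl.
have [q [l' [k' [_ -> ]]]] := live_Branch_next z j v p l k zl bj.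
by rewrite zj1 => -[].
Qed.

(** After the last jump every [Branch] node refuses one more exit and keeps its designated point. *)
Lemma constant_point z : live z -> ~ jumps_forever z ->
  exists N, forall d, point (run z (N + d).*2.+1) = point (run z N.*2.+1) /\
    (d <= refused (run z (N + d).*2.+1))%N.
Proof.
move=> zl /existsNP[N nj]; exists N; elim=> [|d [IHp IHk]]; first by rewrite addn0.
have [v [p [l [k bj]]]] := live_Branch z (N + d) zl.
have [q [l' [k' [_ bj' ]]]] := live_Branch_next z (N + d) v p l k zl bj.
rewrite addnS bj' bj /= in IHp IHk *.
case: ifP => [zd|_ [-> _ ->]]; last by split.
by case: nj; exists (N + d)%N => //; exact: leq_addr.
Qed.

(** If the jumps stop, the last designated point is reachable throughout. Otherwise the codes of the
    designated points converge, and closedness of the set of codes supplies the point. *)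
Lemma live_reachable z : live z -> exists b, forall n, reachable (run z n) b.
Proof.
move=> zl; have [zj|/(constant_point z zl)[N NP]] := pselect (jumps_forever z); last first.
  exists (point (run z N.*2.+1)) => n.
  have nN : (n <= (N + n).*2.+1)%N by rewrite -addnn; lia.
  apply: (reachable_run_le _ _ _ _ nN).
  by have [<- _] := NP n; exact: live_reachable_point.
have /choice[J JP] i : exists j, (i < level (run z j.*2.+1))%N.
  by have [j ? _] := level_unbounded z i.+1 zl zj; exists j.
pose q j := point (run z j.*2.+1).
have qq i j : (i <= j)%N -> agree (level (run z i.*2.+1)) (w (q j)) (w (q i)).
  move=> ij; apply: reachable_agree; have := live_reachable_point z j.*2.+1 zl erefl.
  by apply: reachable_run_le; rewrite ltnS leq_double.
(* At round [J i] the level exceeds [i], so the [i]-th digit of the codes has stabilised. *)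
pose x i := w (q (J i)) i.
have qx j : agree (level (run z j.*2.+1)) (w (q j)) x.
  move=> i il; rewrite /x.
  have h1 := qq j (maxn j (J i)) (leq_maxl _ _) i il.
  have h2 := qq (J i) (maxn j (J i)) (leq_maxr _ _) i (JP i).
  by rewrite -h1 h2.
have [|b Bb bx] := wclosed x.
  move=> n; have [j nj _] := level_unbounded z n zl zj; exists (q j).
    exact: live_point.
  by apply: agree_le nj _; exact: qx.
exists b => n.
(* Just after a jump no exit has been refused, so reachability is mere agreement of codes up to the
   level. *)
suff [j nj rj] : exists2 j, (n <= j)%N & refused (run z j.*2.+1) = 0%N.
  have nj' : (n <= j.*2.+1)%N by rewrite -addnn; lia.
  apply: (reachable_run_le _ _ _ _ nj'); have := qx j; rewrite /q.
  have [v [p [l [k bj]]]] := live_Branch z j zl; rewrite bj /= in rj *.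
  by rewrite rj -bx => pb; split=> //; exact: agree_sym.
have [j nj zj1] := zj n; exists j.+1; first exact: leqW.
have [v [p [l [k bj]]]] := live_Branch z j zl.
have [q' [l' [k' [_ -> ]]]] := live_Branch_next z j v p l k zl bj.
by rewrite zj1 => -[].
Qed.

(** With infinitely many jumps, [b] agrees with the designated points to ever greater depth.
    Otherwise all exits are eventually refused, so the code of [b] never leaves that of the last
    designated point. *)
Lemma reachable_point_cvg z b : (forall n, reachable (run z n) b) ->
  (fun j => point (run z j.*2.+1)) @ \oo --> b.
Proof.
move=> zb; have zl := reachable_live z b zb; have Bb : B b := zb 0%N.
apply/cvgrPdist_lt => e /wcont[m mP].
have [zj|/(constant_point z zl)[N NP]] := pselect (jumps_forever z).
  have [i mi _] := level_unbounded z m zl zj; exists i => // j ij.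
  apply: mP => //; first exact: live_point.
  apply: agree_le (leq_trans mi (level_mono z i j zl ij)) _.
  exact: reachable_agree.
suff bp n : agree n (w b) (w (point (run z N.*2.+1))).
  exists N => // j /subnKC <-; have [-> _] := NP (j - N)%N.
  by apply: mP => //; exact: live_point.
elim: n => // n IH; apply/agreeS; split=> //; apply: contrapT => ne.
(* The exit that [b] would take at a first disagreement; it has been refused [k.+1] rounds after
   [N]. *)
pose k := pickle (n, w b n).
have [pk kk] := NP k.+1; have := zb (N + k.+1).*2.+1.
move: pk kk; have [v [p [l [k' ->]]]] := live_Branch z (N + k.+1) zl.
rewrite /= => -> kk [_ _ /(_ k kk)]; apply.
by exists n.
Qed.

(** * Convergence of the martingale *)

Hypothesis B01 : B `<=` `]0, 1[.

Definition well_formed (s : state) : Prop :=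
  match s with
  | Start => True
  | Final v => dyadic v /\ 0 <= v <= 1
  | Branch v p _ _ => [/\ dyadic v, 0 < v < 1 & B p]
  | Move v p _ _ => [/\ dyadic v, 0 < v < 1 & B p]
  end.

Lemma well_formed_next n s d : well_formed s -> well_formed (next n s d).
Proof.
have dbl (v : R) : dyadic v -> dyadic (2 * v) by move=> dv; exact: dyadicM (dyadic_nat 2) dv.
case: s => [_|v|v p l k|v p l k] /=.
- case: ifP => [/andP[_ /asboolP B0]|_] /=; last by split; [exact: dyadic_half|lra].
  split; [exact: dyadic_half|lra|].
  by have [b Bb] := B0; exact: xgetI Bb.
- move=> [dv v01]; case: ifP => [h|/negbT]; last rewrite -ltNge => h; case: d.
  + by split; [exact: (dyadic_nat 0)|lra].
  + by split; [exact: dbl|lra].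
  + by split; [exact: (dyadic_nat 1)|lra].
  + by split; [apply: dyadicB (dbl _ dv) (dyadic_nat 1)|lra].
- move=> [dv v01 Bp]; case: d => //=.
  case: asboolP => [/exitsP[[Bq _ _] _]|_] /=; first by split.
  by split=> //; lra.
- move=> [dv v01 Bp].
  have p01 : 0 < p < 1 by have := B01 _ Bp; rewrite /= in_itv.
  have [s1 s2] := step_bounds _ _ v01 (dyadic_approx01 n p p01).
  have ds : dyadic (step v (dyadic_approx n p)).
    by apply: dyadic_step => //; exact: dyadic_dyadic_approx.
  by case: d => /=; split=> //; apply: dyadicB => //; exact: dbl.
Qed.

Lemma well_formed_run z n : well_formed (run z n).
Proof. by elim: n => // n IH; rewrite runS; exact: well_formed_next. Qed.

Lemma dens_martingale n s :
  dens s = (dens (next n s false) + dens (next n s true)) / 2.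
Proof.
case: s => [|v|v p l k|v p l k] /=; last by field.
- by case: ifP => _ /=; field.
- by case: ifP => _; field.
- by case: ifP => _ /=; field.
Qed.

Lemma run_dens_cvg z b :
  (forall n, reachable (run z n) b) ->
  (fun n => dens (run z n)) @ \oo --> b.
Proof.
move=> zb; have zl := reachable_live z b zb.
have Bb : B b := zb 0%N; have b01 : 0 < b < 1 by have := B01 _ Bb; rewrite /= in_itv.
pose u j := dens (run z j.*2.+1).
pose q j := point (run z j.*2.+1).
(* The index is [j.+1] because the move at time [j.*2.+2] already aims at the point selected by the
   preceding [Branch] node. *)
pose t j := dyadic_approx j.*2.+2 (q j.+1).
have uS j : u j.+1 = step (u j) (t j) /\ dens (run z j.*2.+2) = u j.
  have [v [p [l [k bj]]]] := live_Branch z j zl.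
  have [q' [l' [k' [mj bj' _]]]] := live_Branch_next z j v p l k zl bj.
  by rewrite /u /t /q mj bj' bj.
have u0 : 0 < u 0%N < 1.
  rewrite /u; have := well_formed_run z 1%N.
  by have [v [p [l [k ->]]]] := live_Branch z 0%N zl => -[].
have t01 j : 0 <= t j < 1.
  apply: dyadic_approx01.
  by have := B01 _ (live_point z j.+1.*2.+1 zl erefl); rewrite /= in_itv.
have qb : q @ \oo --> b := reachable_point_cvg  z b zb.
have tb : t @ \oo --> b.
  have q1b : (fun j => q j.+1) @ \oo --> b by rewrite (cvg_shiftS q).
  apply: (@squeeze_cvgr _ _ _ _ (fun j => q j.+1 - 2^-1 ^+ j) (fun j => q j.+1)) => //.
    apply: nearW => j; have /andP[h1 ->] := dyadic_approx_bounds j.*2.+2 (q j.+1).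
    rewrite andbT (le_trans _ h1) // lerB // half_expr_le // -addnn.
    exact: leq_trans (leq_addr _ _) (leq_trans (leqnSn _) (leqnSn _)).
  rewrite -[X in _ --> X]subr0; apply: cvgB => //.
  by apply: cvg_expr; rewrite ger0_norm ?invr_ge0 //; lra.
have ub := step_cvg u t b b01 u0 t01 (fun j => (uS j).1) tb.
apply/cvgrPdist_lt => e e0; have /cvgrPdist_lt/(_ e e0)[N _ uN] := ub.
exists N.*2.+1 => // -[//|n] Nn.
have E : dens (run z n.+1) = u n./2.
  rewrite -{1}(odd_double_half n); case: (odd n); last by [].
  exact: (uS _).2.
rewrite E; apply: uN => /=; rewrite -(doubleK N); exact: half_leq.
Qed.

Lemma run_Final z n m v : v = 0 \/ v = 1 -> run z n = Final v ->
  run z (n + m) = Final v.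
Proof.
move=> v01 zn; elim: m => [|m IH]; first by rewrite addn0.
rewrite addnS runS IH /=; congr Final; case: v01 => ->.
  by rewrite divr_ge0 // mulr0; case: ifP.
by rewrite leNgt (_ : 1 / 2 < 1) /=; [case: ifP => // _; ring|lra].
Qed.

Lemma int01 (v : R) : v \is a Num.int -> 0 <= v <= 1 -> v = 0 \/ v = 1.
Proof.
move=> /intrP[k ->]; rewrite ler0z lerz1 => /andP[k0 k1].
have [->|->] : k = 0 \/ k = 1 by lia.
  by left.
by right.
Qed.

Lemma final_halve n m v d : 2 ^+ m.+1 * v \is a Num.int -> 0 <= v <= 1 ->
  exists v', [/\ next n (Final v) d = Final v',
    2 ^+ m * v' \is a Num.int & 0 <= v' <= 1].
Proof.
move=> vm v01; rewrite /=.
have mi k : 2 ^+ m * k%:R \is a @Num.int R by rewrite rpredM ?rpredX ?rpred_nat.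
have dbl : 2 ^+ m * (2 * v) \is a Num.int by rewrite mulrA -exprSr.
case: ifP => [h|/negbT]; last rewrite -ltNge => h; case: d; eexists; split=> //; try lra.
- exact: (mi 0%N).
- exact: (mi 1%N).
- by rewrite mulrBr rpredB //; exact: (mi 1%N).
Qed.

(** Each step lowers the dyadic exponent by one, and an integer between 0 and 1 is 0 or 1. *)
Lemma run_Final_ends z n v : run z n = Final v ->
  exists N r, (r = 0 \/ r = 1) /\ run z N = Final r.
Proof.
move=> zn; have := well_formed_run z n; rewrite zn => -[[m vm] v01].
elim: m n v zn vm v01 => [|m IH] n v zn vm v01.
  by exists n, v; split=> //; apply: int01 => //; rewrite expr0 mul1r in vm.
have [v' [nv vm' v01']] := final_halve n m v (z n) vm v01.
by apply: (IH n.+1 v') => //; rewrite runS zn.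
Qed.

(** * Sets having the martingale as their density *)

Definition hits (r : R) : set cantor_space := [set z | exists n, run z n = Final r].

Lemma hits_agree r n z z' : agree n z z' ->
  run z n = Final r -> run z' n = Final r.
Proof. by move=> /(run_agree) ->. Qed.

Lemma hits_disjoint z : hits 1 z -> ~ hits 0 z.
Proof.
move=> [n zn] [m zm].
have := run_Final z n m 1 (or_intror erefl) zn.
rewrite addnC (run_Final z m n 0 (or_introl erefl) zm) => -[] /eqP.
by rewrite eq_sym oner_eq0.
Qed.

Lemma run_set_digit z n d :
  run (set_digit z n d) n.+1 = next n (run z n) d.
Proof. by rewrite runS set_digit_eq (run_agree n _ z (agree_set_digit z n d)). Qed.

(** Only the inclusions around [X] matter, so the open and the closed realization are treated at
    once. The induction on the dyadic exponent ends at cylinders inside [X] or disjoint from it. *)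
Lemma density_ratio_Final X z n v : coin_measurable R X ->
  hits 1 `<=` X -> X `<=` ~` hits 0 ->
  run z n = Final v -> density_ratio X z n = v.
Proof.
move=> mX X1 X0 zn; have := well_formed_run z n; rewrite zn => -[[m vm] v01].
elim: m z n v zn vm v01 => [|m IH] z n v zn vm v01.
  rewrite expr0 mul1r in vm; case: (int01 v vm v01) => v_.
    apply: etrans (esym v_); apply: density_ratio0 => x xz Xx.
    apply: (X0 _ Xx); exists n; rewrite -v_; apply: hits_agree zn.
    exact: agree_sym.
  apply: etrans (esym v_); apply: density_ratio1 => x xz.
  apply: X1; exists n; rewrite -v_; apply: hits_agree zn.
  exact: agree_sym.
rewrite density_ratio_split //.
have [v0 [n0 m0 h0]] := final_halve n m v false vm v01.
have [v1 [n1 m1 h1]] := final_halve n m v true vm v01.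
rewrite (IH _ _ v0) ?run_set_digit ?zn //.
rewrite (IH _ _ v1) ?run_set_digit ?zn //.
have := dens_martingale n (Final v); by rewrite n0 n1 => /= <-.
Qed.

(* The error halves at each [Move] node since one of its children is [Final];
   this is where the set of live branches is seen to be negligible. *)
Lemma density_ratio_run X z n : coin_measurable R X ->
  hits 1 `<=` X -> X `<=` ~` hits 0 ->
  density_ratio X z n = dens (run z n).
Proof.
move=> mX X1 X0.
pose err z n := density_ratio X z n - dens (run z n).
have errE z' n' : err z' n' =
    (err (set_digit z' n' false) n'.+1 + err (set_digit z' n' true) n'.+1) / 2.
  rewrite /err density_ratio_split // !run_set_digit (dens_martingale n' (run z' n')).
  by field.
have errF z' n' v : run z' n' = Final v -> err z' n' = 0.
  by move=> zn; rewrite /err (density_ratio_Final _ _ _ v) // zn subrr.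
(* In the inductive step a [Move] node gets half the bound of its [Branch] child, and a [Branch]
   node then inherits the improved bound from its children. *)
have errle j : (forall z n v p l k, run z n = Branch v p l k -> `|err z n| <= 2^-1 ^+ j) /\
    (forall z n v p l k, run z n = Move v p l k -> `|err z n| <= 2^-1 ^+ j).
  elim: j => [|j [IHb IHm]].
    have h z' n' : `|err z' n'| <= 1 \/ exists v, run z' n' = Final v.
      have := well_formed_run z' n'; have := density_ratio_bounds X z' n' mX.
      rewrite /err; case: (run z' n') => [|v|v p l k|v p l k] /=; last 2 first.
      - by move=> /andP[? ?] [_ /andP[? ?] _]; left; rewrite ler_norml; apply/andP; split; lra.
      - by move=> /andP[? ?] [_ /andP[? ?] _]; left; rewrite ler_norml; apply/andP; split; lra.
      - by move=> /andP[? ?] _; left; rewrite ler_norml; apply/andP; split; lra.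
      - by right; exists v.
    rewrite expr0; split=> z' n' v p l k zn.
      by have [//|[v' zn']] := h z' n'; rewrite zn in zn'.
    by have [//|[v' zn']] := h z' n'; rewrite zn in zn'.
  have Hm z' n' v p l k : run z' n' = Move v p l k -> `|err z' n'| <= 2^-1 ^+ j.+1.
    move=> zn; rewrite errE.
    rewrite (errF (set_digit z' n' true) n'.+1
      (2 * v - step v (dyadic_approx n' p))).
      rewrite addr0 normrM [`|2^-1|]ger0_norm ?invr_ge0 // exprSr ler_wpM2r ?invr_ge0 //.
      by apply: (IHb _ _ (step v (dyadic_approx n' p)) p l k); rewrite run_set_digit zn.
    by rewrite run_set_digit zn.
  split=> // z' n' v p l k zn.
  have child d : `|err (set_digit z' n' d) n'.+1| <= 2^-1 ^+ j.+1.
    have := run_set_digit z' n' d; rewrite zn; case: d; rewrite [next _ _ _]/=; last exact: Hm.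
    by case: ifP => _; [exact: Hm|move=> /errF ->; rewrite normr0 ltW ?half_expr_gt0].
  rewrite errE normrM [`|2^-1|]ger0_norm ?invr_ge0 // ler_pdivrMr //.
  by apply: le_trans (ler_normD _ _) _; have := child false; have := child true; lra.
(* [Start] occurs only at time 0, where the error vanishes by averaging over the children. *)
have err0 z' n' : (0 < n')%N -> err z' n' = 0.
  case: n' => // n' _; apply/eqP; rewrite -normr_le0; apply/ler_addgt0Pl => e e0.
  have [j je] := half_expr_small e e0; rewrite addr0.
  have [hb hm] := errle j.
  case E : (run z' n'.+1) => [|v|v p l k|v p l k].
  - exfalso; move: E; rewrite runS; case: (run z' n') => [|v|v p l k|v p l k] /=.
    + by case: ifP.
    + by [].
    + by case: ifP => // _; case: ifP.
    + by case: ifP.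
  - by rewrite (errF _ _ _ E) normr0 ltW.
  - by apply: le_trans (ltW je); exact: hb E.
  - by apply: le_trans (ltW je); exact: hm E.
by apply/eqP; rewrite -subr_eq0 -/(err z n) errE !err0 // addr0 mul0r.
Qed.

Lemma dens_live_cvg z : live z ->
  exists b, [/\ B b, forall n, reachable (run z n) b &
    (fun n => dens (run z n)) @ \oo --> b].
Proof.
move=> zl; have [b zb] := live_reachable z zl.
by exists b; split=> //; [exact: (zb 0%N)|exact: run_dens_cvg].
Qed.

Lemma dens_final_cvg z N (r : R) : r = 0 \/ r = 1 -> run z N = Final r ->
  (fun n => dens (run z n)) @ \oo --> r.
Proof.
move=> r01 zN; apply: cvg_near_cst; exists N => // n /= /subnKC <-.
by rewrite (run_Final z N _ r r01 zN).
Qed.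

Lemma dens_cvg_cases z : live z \/
  exists2 r : R, r = 0 \/ r = 1 & (fun n => dens (run z n)) @ \oo --> r.
Proof.
have [zl|/existsNP[n /existsNP[v /contrapT zn]]] := pselect (live z); first by left.
have [N [r [r01 zN]]] := run_Final_ends z n v zn.
by right; exists r => //; exact: dens_final_cvg zN.
Qed.

Lemma solid_realization X : coin_measurable R X ->
  hits 1 `<=` X -> X `<=` ~` hits 0 ->
  [/\ solid R X, ran_density X = [set 0; 1] `|` B & Rng_inj R X].
Proof.
move=> mX X1 X0.
have dE z (r : R) : density_at X z r <-> (fun n => dens (run z n)) @ \oo --> r.
  rewrite /density_at (_ : (fun n => _) = (fun n => dens (run z n))) //.
  by apply/funext => n; exact: density_ratio_run.
have duniq z (r r' : R) : density_at X z r ->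
    (fun n => dens (run z n)) @ \oo --> r' -> r = r'.
  by move=> /dE zr zr'; exact: cvg_unique zr zr'.
split.
- move=> z; have [/dens_live_cvg[b [_ _ zb]]|[r _ zr]] := dens_cvg_cases z.
    by exists b; exact/dE.
  by exists r; exact/dE.
- apply/seteqP; split=> r /=.
    move=> [z zr]; have [/dens_live_cvg[b [Bb _ zb]]|[r' r01 zr']] := dens_cvg_cases z.
      by right; rewrite (duniq _ _ _ zr zb).
    by left; rewrite (duniq _ _ _ zr zr').
  move=> [r01|/exists_path[z zr]]; last by exists z; apply/dE; exact: run_dens_cvg.
  (* Digit 0 at [Start] leads to [Final (1 / 2)], from which digit 1 gives density 0 and digit 0
     gives density 1. *)
  case: r01 => ->; [exists (fun n => n == 1%N)|exists (fun=> false)]; apply/dE.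
    apply: (dens_final_cvg _ 2%N); first by left.
    by rewrite /= lexx.
  apply: (dens_final_cvg _ 2%N); first by right.
  by rewrite /= lexx; congr Final; field.
- move=> z z' r /andP[r0 r1] zr zr'.
  (* A density strictly between 0 and 1 forces the branch to be live, and its value is then the
     point of [B] that the branch follows. *)
  have rlive y : density_at X y r -> forall n, reachable (run y n) r.
    move=> yr; have [/dens_live_cvg[b [_ yb yc]]|[r' r01 yr']] := dens_cvg_cases y.
      by rewrite (duniq _ _ _ yr yc).
    by exfalso; move: r01; rewrite -(duniq _ _ _ yr yr'); lra.
  exact: path_inj (rlive z zr) (rlive z' zr').
Qed.

End Automaton.

Theorem theorem5p3 (R : realType) (B : set R) :
  @measurable _ (measurableTypeR R) B -> B `<=` `]0, 1[ ->
  (exists A : set cantor_space, closed A /\ solid R A /\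
     ran_density A = [set 0; 1] `|` B /\ Rng_inj R A) /\
  (exists A : set cantor_space, open A /\ solid R A /\
     ran_density A = [set 0; 1] `|` B /\ Rng_inj R A).
Proof.
move=> mB B01; have [w [wcont wclosed]] := borel_code R B mB B01.
have main := solid_realization R B w wcont wclosed B01.
have mh r := coin_measurable_exists R _ (hits_agree R B w r).
have oh r := cantor_open_exists _ (hits_agree R B w r).
have d10 := hits_disjoint R B w.
split.
- have [] := main (~` hits R B w 0) (coin_measurableC R _ (mh 0)) d10 (fun x => id).
  by exists (~` hits R B w 0); split=> //; exact: open_closedC (oh 0).
- have [] := main (hits R B w 1) (mh 1) (fun x => id) d10.
  by exists (hits R B w 1); split=> //; exact: oh.
Qed.
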